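(* Suppose the data $(T,\mathcal{D},K,(e_k),(B^k),f,u_0)$ satisfy (A1)–(A5) and let $\mathcal{T}_h$ be an admissible triangulation of $\mathcal{D}$ satisfying (T1)–(T2). Let $M\in\mathbb{N}$ and $\tau=T/M$. Then the fully discrete Lie–Trotter scheme $(U^{LT,h}_m)_{m=0}^M\subset\mathbb{R}^{n_h}$ given by $$U^{LT,h}_0=(u_0(P_j))_{j=1}^{n_h},\qquad U^{LT,h}_{m+1}=\exp\left(-\tau\mathcal{M}_L^{-1}\mathcal{S}\right)\exp\left(\sum_{k=1}^K\delta B^k_m D_{g(U_m^{LT,h})}D_{e_k}-\frac{\tau}{2}\sum_{k=1}^K D_{g(U_m^{LT,h})}^2D_{e_k}^2\right)U_m^{LT,h},\quad 0\le m\le M-1,$$ is nonnegative, i.e. every component of $U^{LT,h}_m$ is nonnegative for every $m=0,\dots,M$.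
   Context: **Data.** Assumptions: (A1) $T\in(0,\infty)$ and $\mathcal{D}\subset\mathbb{R}^d$, $d\in\{1,2,3\}$, is either a non-empty, bounded, open polyhedral domain or a non-empty, bounded, open, convex domain with $C^2$ boundary. (A2) The Laplacian $\Delta$ is taken with homogeneous Dirichlet boundary conditions, $\Delta:H^1_0(\mathcal{D})\cap H^2(\mathcal{D})\subset L^2(\mathcal{D})\to L^2(\mathcal{D})$. (A3) $K\in\mathbb{N}$; $B^1,\dots,B^K$ are independent one-dimensional Brownian motions on a complete probability space with normal filtration $(\Omega,\mathcal{F},(\mathcal{F}_t)_{t\in[0,T]},\mathbb{P})$; $e_1,\dots,e_K\in C(\overline{\mathcal{D}})$ are pairwise $L^2(\mathcal{D})$-orthonormal. (A4) $f:\mathbb{R}\to\mathbb{R}$ is $C^1$, globally Lipschitz with constant $L_f\ge0$, and $f(0)=0$. (A5) $u_0\in H^2(\mathcal{D})\cap C_0(\overline{\mathcal{D}})$ and $u_0\ge0$, where $C_0(\overline{\mathcal{D}})$ denotes continuous functions on $\overline{\mathcal{D}}$ vanishing on $\partial\mathcal{D}$. Define $g(s)=f(s)/s$ for $s\ne0$ and $g(0)=f'(0)$. **Triangulation.** For polyhedral $\mathcal{D}$, a triangulation is a partition of $\overline{\mathcal{D}}$ into (finitely many) closed $d$-simplices $\mathcal{C}$ with mutually disjoint interiors, and $\mathcal{D}_h:=\mathcal{D}$; for convex $\mathcal{D}$ with $C^2$ boundary it is such a partition of $\overline{\mathcal{D}_h}$, where $\mathcal{D}_h\subset\mathcal{D}$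 is a polyhedral subdomain whose boundary vertices lie on $\partial\mathcal{D}$. It is admissible (conforming) if every vertex meets other simplices only at their vertices, or lies on the boundary. $h$ is the maximal diameter of the simplices. $P_1,\dots,P_{n_h}$ are the vertices in the interior of $\mathcal{D}$. $S_h\subset H^1_0(\mathcal{D})$ is the space of continuous functions on $\mathcal{D}$ vanishing on the boundary, linear on each simplex, zero on $\mathcal{D}\setminus\mathcal{D}_h$, with nodal basis $\Phi_j\in S_h$, $\Phi_j(P_i)=\delta_{ij}$. (T1) (weakly acute) $\int_{\mathcal{C}}\nabla\Phi_i\cdot\nabla\Phi_j\le0$ for every simplex $\mathcal{C}$ and all $i\ne j$. (T2) There is $C_1>0$ with $C_1\operatorname{diam}(\mathcal{C})\le\operatorname{diam}(B_{\mathcal{C}})$ for every simplex $\mathcal{C}$, where $B_{\mathcal{C}}$ is the largest ball contained in $\mathcal{C}$. **Matrices.** $\mathcal{S}=[\int_{\mathcal{D}}\nabla\Phi_j\cdot\nabla\Phi_i]_{i,j}$ (stiffness), $\mathcal{M}_L=[\delta_{ij}\int_{\mathcal{D}}\Phi_i]_{i,j}$ (lumped mass), $D_{e_k}=[e_k(P_i)\delta_{ij}]_{i,j}$, and for $U\in\mathbb{R}^{n_h}$, $D_{g(U)}=[g(U_i)\delta_{ij}]_{i,j}$, all for $1\le i,j\le n_h$. With $t_m=m\tau$, $\delta B^k_m=B^k_{t_{m+1}}-B^k_{t_m}$. *)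

(* Defs.v *)
From HB Require Import structures.
From mathcomp Require Import all_boot all_order all_algebra.
From mathcomp Require Import all_classical all_reals all_analysis.

Set Implicit Arguments.
Unset Strict Implicit.
Unset Printing Implicit Defensive.

Import Order.TTheory GRing.Theory Num.Theory.
Import numFieldNormedType.Exports.

Local Open Scope classical_set_scope.
Local Open Scope ring_scope.

(* The library has no measurable structure on row vectors: 'rV_d gets the
   sigma-algebra generated by the coordinates, the Borel one when T is R. *)

Definition rV_display : measure_display -> measure_display.
Proof. exact. Qed.

Section measurable_rV.
Context {dT : measure_display} {T : measurableType dT}.
Variable d : nat.

Let coors : 'I_d -> 'rV[T]_d -> T := fun i x => x ord0 i.

Let rV_set0 : g_sigma_preimage coors set0.
Proof. exact: sigma_algebra0. Qed.

Let rV_setC A : g_sigma_preimage coors A -> g_sigma_preimage coors (~` A).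
Proof. exact: sigma_algebraC. Qed.

Let rV_bigcup (F : _^nat) : (forall i, g_sigma_preimage coors (F i)) ->
  g_sigma_preimage coors (\bigcup_i (F i)).
Proof. exact: sigma_algebra_bigcup. Qed.

HB.instance Definition _ := @isMeasurable.Build (rV_display dT)
  'rV[T]_d (g_sigma_preimage coors) rV_set0 rV_setC rV_bigcup.

Lemma measurable_coor i : measurable_fun setT (fun x : 'rV[T]_d => x ord0 i).
Proof.
move=> _ Y mY; rewrite setTI; apply: sub_sigma_algebra => /=.
rewrite -bigcup_seq/=; exists i => /=; first by rewrite mem_index_enum.
by exists Y => //; rewrite setTI.
Qed.

Lemma measurable_fun_coor d' (S : measurableType d') (h : S -> 'rV[T]_d) :
  (forall i, measurable_fun setT (fun s => h s ord0 i)) ->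
  measurable_fun setT h.
Proof.
move=> mh _ A mA; rewrite setTI.
suff sub : (g_sigma_preimage coors : set (set _)) `<=`
    [set A | measurable (h @^-1` A)] by exact: (sub _ mA).
apply: smallest_sub => [|B].
  split => [|C mC|C mC] /=; first by rewrite preimage_set0; exact: measurable0.
  - by rewrite setTD preimage_setC; exact: measurableC.
  - by rewrite preimage_bigcup; apply: bigcup_measurable => k _; exact: mC.
rewrite -bigcup_seq => -[i _ [Y mY <-]] /=.
by rewrite setTI; have := mh i measurableT Y mY; rewrite setTI.
Qed.

End measurable_rV.

(* d-dimensional Lebesgue measure: product of d copies of the one-dimensional
   one, transported from R * R^d to R^(d+1). *)

Section lebesgue_rV.
Variable R : realType.

(* [lebesgue_measure] lives on [measurableTypeR R]; this is the same function
   on the canonical measurable structure of R, which has the same measurable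
   sets but another display. *)
Definition lebesgue1 : set R -> \bar R := @lebesgue_measure R.

Let lebesgue1_0 : lebesgue1 set0 = 0%E.
Proof. exact: (measure0 (@lebesgue_measure R)). Qed.

Let lebesgue1_ge0 A : (0 <= lebesgue1 A)%E.
Proof. exact: (measure_ge0 (@lebesgue_measure R)). Qed.

Let lebesgue1_sigma_additive : semi_sigma_additive lebesgue1.
Proof. exact: (@measure_semi_sigma_additive _ _ _ (@lebesgue_measure R)). Qed.

HB.instance Definition _ := isMeasure.Build _ _ _
  lebesgue1 lebesgue1_0 lebesgue1_ge0 lebesgue1_sigma_additive.

Let lebesgue1_sigma_finite : sigma_finite setT lebesgue1.
Proof. exact: (sigma_finiteT (@lebesgue_measure R)). Qed.

HB.instance Definition _ := Measure_isSigmaFinite.Build _ _ _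
  lebesgue1 lebesgue1_sigma_finite.

Definition consrV d (p : R * 'rV[R]_d) :
  'rV[R]_d.+1 := row_mx p.1%:M p.2.

Lemma consrV0 d (p : R * 'rV[R]_d) :
  consrV p ord0 ord0 = p.1.
Proof.
have -> : ord0 = lshift d (ord0 : 'I_1) :> 'I_(1 + d) by apply: val_inj.
by rewrite /consrV (@row_mxEl _ 1 1 d) mxE eqxx.
Qed.

Lemma consrVS d (p : R * 'rV[R]_d) j :
  consrV p ord0 (lift ord0 j) = p.2 ord0 j.
Proof.
have -> : lift ord0 j = rshift 1 j :> 'I_(1 + d) by apply: val_inj.
by rewrite /consrV (@row_mxEr _ 1 1 d).
Qed.

Lemma measurable_consrV d : measurable_fun setT (@consrV d).
Proof.
apply: measurable_fun_coor => i; case: (unliftP ord0 i) => [j ->|->].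
  under eq_fun do rewrite consrVS.
  exact: measurableT_comp (measurable_coor j) measurable_snd.
by under eq_fun do rewrite consrV0; exact: measurable_fst.
Qed.

Section step.
Local Open Scope ereal_scope.
Variable d : nat.
Variable m : {sigma_finite_measure set 'rV[R]_d -> \bar R}.

Definition lebesgue_step : set 'rV[R]_d.+1 -> \bar R :=
  pushforward (lebesgue1 \x m) (@consrV d).

Let m_consrV A : measurable A -> measurable (@consrV d @^-1` A).
Proof. by rewrite -[X in _ -> measurable X]setTI; exact: measurable_consrV. Qed.

Let step0 : lebesgue_step set0 = 0.
Proof. by rewrite /lebesgue_step /pushforward preimage_set0 measure0. Qed.

Let step_ge0 A : 0 <= lebesgue_step A.
Proof. by rewrite /lebesgue_step /pushforward. Qed.

Let step_sigma_additive : semi_sigma_additive lebesgue_step.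
Proof.
move=> F mF tF mUF; rewrite /lebesgue_step /pushforward preimage_bigcup.
apply: measure_semi_sigma_additive.
- by move=> n; exact: m_consrV.
- apply/trivIsetP => /= i j _ _ ij; rewrite -preimage_setI.
  by move/trivIsetP : tF => /(_ _ _ _ _ ij) ->//; rewrite preimage_set0.
- by rewrite -preimage_bigcup; exact: m_consrV.
Qed.

HB.instance Definition _ := isMeasure.Build _ _ _
  lebesgue_step step0 step_ge0 step_sigma_additive.

Let unconsrV (x : 'rV[R]_d.+1) :
  R * 'rV[R]_d :=
  (x ord0 ord0, \row_j x ord0 (lift ord0 j)).

Let consrVK : cancel (@consrV d) unconsrV.
Proof.
move=> [a v]; rewrite /unconsrV consrV0; congr pair.
by apply/rowP => j; rewrite mxE consrVS.
Qed.

Let measurable_unconsrV : measurable_fun setT unconsrV.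
Proof.
apply/measurable_fun_pairP; split; first exact: measurable_coor.
apply: measurable_fun_coor => i.
rewrite (_ : (fun _ => _) = (fun x : 'rV_d.+1 => x ord0 (lift ord0 i))).
  exact: measurable_coor.
by apply/funext => x; rewrite /= mxE.
Qed.

Let step_sigma_finite : sigma_finite setT lebesgue_step.
Proof.
have /sigma_finiteP[F [TF ndF Foo]] := sigma_finiteT lebesgue1.
have /sigma_finiteP[G [TG ndG Goo]] := sigma_finiteT m.
exists (fun n => unconsrV @^-1` (F n `*` G n)).
  rewrite -preimage_bigcup (_ : \bigcup_n _ = setT) ?preimage_setT//.
  apply/seteqP; split => // -[x y] _.
  have : setT x by []. rewrite TF => -[n _ Fnx].
  have : setT y by []. rewrite TG => -[k _ Gky].
  exists (maxn n k) => //; split => /=.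
  - by move: x Fnx; exact/subsetPset/ndF/leq_maxl.
  - by move: y Gky; exact/subsetPset/ndG/leq_maxr.
move=> n; have [? ?] := Foo n; have [? ?] := Goo n; split.
  rewrite -[X in measurable X]setTI.
  by apply: measurable_unconsrV => //; exact: measurableX.
rewrite /lebesgue_step /pushforward -comp_preimage.
rewrite (_ : unconsrV \o _ = id); last by apply/funext => p /=; rewrite consrVK.
by rewrite preimage_id product_measure1E// lte_mul_pinfty// ge0_fin_numE.
Qed.

HB.instance Definition _ := Measure_isSigmaFinite.Build _ _ _
  lebesgue_step step_sigma_finite.

End step.

Fixpoint lebesgue_rV d :
    {sigma_finite_measure set 'rV[R]_d -> \bar R} :=
  if d is d'.+1 return
    {sigma_finite_measure set 'rV[R]_d -> \bar R}
  then lebesgue_step (lebesgue_rV d') 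
  else @dirac _ 'rV[R]_0 (0 : 'rV[R]_0) R.

Lemma lebesgue_rV_box d (A : 'I_d -> set R) :
  (forall i, measurable (A i)) ->
  lebesgue_rV d [set x | forall i, A i (x ord0 i)] =
  (\prod_(i < d) lebesgue1 (A i))%E.
Proof.
elim: d A => [|d IHd] A mA.
  rewrite big_ord0 /= diracE (_ : (0 : 'rV_0) \in _) // inE => -[].
  by [].
rewrite big_ord_recl -IHd => [|i]; last exact: mA.
rewrite /= /lebesgue_step /pushforward.
have mB : measurable [set x : 'rV[R]_d | forall i, A (lift ord0 i) (x ord0 i)].
  rewrite (_ : [set _ | _] =
    \bigcap_(i in setT) ((fun x : 'rV_d => x ord0 i) @^-1` A (lift ord0 i))).
    apply: fin_bigcap_measurable => // i _.
    by rewrite -[X in measurable X]setTI; exact: measurable_coor.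
  by apply/seteqP; split => x /= h i => [_|]; exact: h.
rewrite -product_measure1E //.
congr (_ _); apply/seteqP; split => -[a v] /= h.
  split => [|i]; first by have := h ord0; rewrite consrV0.
  by have := h (lift ord0 i); rewrite consrVS.
case: h => h0 hv i; case: (unliftP ord0 i) => [j ->|->].
  by rewrite consrVS; exact: hv.
by rewrite consrV0.
Qed.

End lebesgue_rV.

(* The norm carried by 'rV_d in the library is the sup norm; it induces the
   usual topology of R^d, but lengths and balls below are Euclidean. *)

Section geometry.
Variable R : realType.

Definition dotp d (x y : 'rV[R]_d) : R := \sum_i x ord0 i * y ord0 i.

Definition enorm d (x : 'rV[R]_d) : R := Num.sqrt (dotp x x).

Definition eball d (c : 'rV[R]_d) (r : R) : set 'rV[R]_d :=
  [set x | enorm (x - c) <= r].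

Definition diam d (A : set 'rV[R]_d) : R :=
  sup [set r | exists x y, [/\ A x, A y & r = enorm (x - y)]].

Definition boundary d (A : set 'rV[R]_d) : set 'rV[R]_d :=
  closure A `\` A^°.

Definition partial d (i : 'I_d) (u : 'rV[R]_d -> R) (x : 'rV[R]_d) : R :=
  'D_(delta_mx ord0 i) u x.

(* Pointwise gradient. A continuous piecewise affine function is smooth off the
   faces of the mesh, a null set, so integrals of [grad] see its weak gradient. *)
Definition grad d (u : 'rV[R]_d -> R) (x : 'rV[R]_d) : 'rV[R]_d :=
  \row_i partial i u x.

(* [class_C k U u]: u is of class C^k on the open set U. *)
Fixpoint class_C d (k : nat) (U : set 'rV[R]_d) (u : 'rV[R]_d -> R) : Prop :=
  (forall x, U x -> {for x, continuous u}) /\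
  (if k is k'.+1 then
     forall i, (forall x, U x -> derivable u x (delta_mx ord0 i)) /\
               class_C k' U (partial i u)
   else True).

Definition domain d (D : set 'rV[R]_d) : Prop :=
  [/\ D !=set0, bounded_set D, open D & connected D].

(* A simplex is given by the matrix whose rows are its vertices. *)
Definition simplex d (V : 'M[R]_(d.+1, d)) : set 'rV[R]_d :=
  [set x | exists l : 'rV[R]_d.+1,
    [/\ forall i, 0 <= l ord0 i, \sum_i l ord0 i = 1 & x = l *m V]].

Definition nondegenerate d (V : 'M[R]_(d.+1, d)) : bool :=
  row_free (\matrix_(i < d) (row (lift ord0 i) V - row ord0 V)).

Definition is_vertex d (V : 'M[R]_(d.+1, d)) (x : 'rV[R]_d) : Prop :=
  exists i, x = row i V.

(* The interior of a finite union of d-simplices. *)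
Definition polyhedral d (D : set 'rV[R]_d) : Prop :=
  exists (N : nat) (V : 'I_N -> 'M[R]_(d.+1, d)),
    (forall k, nondegenerate (V k)) /\ D = (\bigcup_k simplex (V k))^°.

(* Local C^2 defining functions with nonvanishing gradient. *)
Definition boundary_C2 d (D : set 'rV[R]_d) : Prop :=
  forall x, boundary D x -> exists (U : set 'rV[R]_d) (rho : 'rV[R]_d -> R),
    [/\ open U, U x, class_C 2 U rho, (forall y, U y -> grad rho y != 0) &
        forall y, U y -> (D y <-> rho y < 0)].

Definition polyhedral_domain d (D : set 'rV[R]_d) : Prop :=
  domain D /\ polyhedral D.

Definition convex_C2_domain d (D : set 'rV[R]_d) : Prop :=
  [/\ domain D, convex_set (D : set (convex_lmodType 'rV[R]_d)) &
      boundary_C2 D].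

End geometry.

Section function_spaces.
Variables (R : realType) (d : nat) (D : set 'rV[R]_d).
Implicit Types u v : 'rV[R]_d -> R.

Local Notation leb := (lebesgue_rV R d).

Definition square_integrable u : Prop :=
  measurable_fun D u /\ leb.-integrable D (fun x => (u x ^+ 2)%:E).

Definition test_function u : Prop :=
  (forall k, class_C k setT u) /\
  exists A : set 'rV[R]_d, [/\ compact A, A `<=` D & forall x, ~ A x -> u x = 0].

Definition weak_partial (i : 'I_d) u v : Prop :=
  forall phi, test_function phi ->
    \int[leb]_(x in D) (u x * partial i phi x) =
    - \int[leb]_(x in D) (v x * phi x).

(* H^k(D); an L^2 class is represented by any of its Borel members. *)
Fixpoint sobolev (k : nat) u : Prop :=
  square_integrable u /\
  (if k is k'.+1 then
     forall i, exists v, weak_partial i u v /\ sobolev k' v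
   else True).

Definition continuous_closure u : Prop := {within closure D, continuous u}.

Definition C0_closure u : Prop :=
  continuous_closure u /\ forall x, boundary D x -> u x = 0.

Definition orthonormal_L2 (K : nat) (e : 'I_K -> 'rV[R]_d -> R) : Prop :=
  forall k l, \int[leb]_(x in D) (e k x * e l x) = (k == l)%:R.

End function_spaces.

Section stochastic_basis.
Context (dO : measure_display) (Omega : measurableType dO) (R : realType).
Variables (P : probability Omega R) (T : R).

(* Filtrations and processes are indexed by R, constrained on [0, T] only. *)
Definition normal_filtration (F : R -> set (set Omega)) : Prop :=
  [/\ forall t, 0 <= t <= T ->
        sigma_algebra setT (F t) /\ F t `<=` measurable,
      forall s t, 0 <= s -> s <= t -> t <= T -> F s `<=` F t,
      forall A, measurable A -> P A = 0%E -> F 0 A &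
      forall t, 0 <= t < T ->
        \bigcap_(s in [set s | t < s <= T]) F s = F t].

Definition increment_in (B : R -> Omega -> R) (s t : R) (Y : set R) :
    set Omega :=
  [set w | Y (B t w - B s w)].

Definition brownian_motion (F : R -> set (set Omega)) (B : R -> Omega -> R) :
    Prop :=
  [/\ forall t, 0 <= t <= T -> forall Y : set R, measurable Y ->
        F t (B t @^-1` Y),
      {ae P, forall w, B 0 w = 0},
      {ae P, forall w, {within `[0, T], continuous (fun t => B t w)}},
      forall s t, 0 <= s -> s < t -> t <= T -> forall Y : set R, measurable Y ->
        P (increment_in B s t Y) = normal_prob 0 (Num.sqrt (t - s)) Y &
      forall s t, 0 <= s -> s < t -> t <= T -> forall A (Y : set R),
        F s A -> measurable Y ->
        P (A `&` increment_in B s t Y) =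
        (P A * P (increment_in B s t Y))%E].

Definition sigma_process (B : R -> Omega -> R) : set (set Omega) :=
  <<s [set A | exists (t : R) (Y : set R),
        [/\ 0 <= t <= T, measurable Y & A = B t @^-1` Y]] >>.

Definition independent_processes (K : nat) (B : 'I_K -> R -> Omega -> R) :
    Prop :=
  forall A : 'I_K -> set Omega, (forall k, sigma_process (B k) (A k)) ->
    P (\bigcap_k A k) = (\prod_k P (A k))%E.

End stochastic_basis.

Section finite_elements.
Variables (R : realType) (d : nat) (D Dh : set 'rV[R]_d).
Variables (N : nat) (V : 'I_N -> 'M[R]_(d.+1, d)).

Local Notation leb := (lebesgue_rV R d).

(* The meshed domain: D itself in the polyhedral case, an inscribed polyhedral
   domain in the smooth convex case. *)
Definition meshed_domain : Prop :=
  (polyhedral_domain D /\ Dh = D) \/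
  [/\ convex_C2_domain D, polyhedral_domain Dh, Dh `<=` D &
      forall k x, is_vertex (V k) x -> boundary Dh x -> boundary D x].

Definition triangulation : Prop :=
  [/\ meshed_domain,
      forall k, nondegenerate (V k),
      closure Dh = \bigcup_k simplex (V k) &
      forall k l, k != l -> (simplex (V k))^° `&` (simplex (V l))^° = set0].

(* A vertex of the mesh that is not on the boundary is a vertex of every simplex
   containing it: no hanging nodes inside. *)
Definition admissible : Prop :=
  forall k x, is_vertex (V k) x ->
    (forall l, simplex (V l) x -> is_vertex (V l) x) \/ boundary Dh x.

Definition interior_vertices (n : nat) (p : 'I_n -> 'rV[R]_d) : Prop :=
  injective p /\
  range p = [set x | D x /\ exists k, is_vertex (V k) x].

Definition fe_space (phi : 'rV[R]_d -> R) : Prop :=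
  [/\ C0_closure D phi,
      (forall k, exists (a : 'rV[R]_d) (b : R),
         forall x, simplex (V k) x -> phi x = dotp a x + b) &
      forall x, D x -> ~ Dh x -> phi x = 0].

Definition nodal_basis (n : nat) (p : 'I_n -> 'rV[R]_d)
    (Phi : 'I_n -> 'rV[R]_d -> R) : Prop :=
  (forall j, fe_space (Phi j)) /\ forall i j, Phi j (p i) = (i == j)%:R.

Definition weakly_acute (n : nat) (Phi : 'I_n -> 'rV[R]_d -> R) : Prop :=
  forall k i j, i != j ->
    \int[leb]_(x in simplex (V k)) dotp (grad (Phi i) x) (grad (Phi j) x) <= 0.

Definition largest_ball (A : set 'rV[R]_d) (c : 'rV[R]_d) (r : R) : Prop :=
  [/\ 0 <= r, eball c r `<=` A & forall c' r', eball c' r' `<=` A -> r' <= r].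

Definition shape_regular : Prop :=
  exists C1 : R, 0 < C1 /\
    forall k, exists c r, largest_ball (simplex (V k)) c r /\
      C1 * diam (simplex (V k)) <= diam (eball c r).

Definition stiffness (n : nat) (Phi : 'I_n -> 'rV[R]_d -> R) : 'M[R]_n :=
  \matrix_(i, j) \int[leb]_(x in D) dotp (grad (Phi j) x) (grad (Phi i) x).

Definition lumped_mass (n : nat) (Phi : 'I_n -> 'rV[R]_d -> R) : 'M[R]_n :=
  \matrix_(i, j) ((i == j)%:R * \int[leb]_(x in D) Phi i x).

End finite_elements.

Section scheme.
Variable R : realType.

(* Exponential series, in the topology of 'M_n; ^+ is the matrix power. *)
Definition expmx n (A : 'M[R]_n) : 'M[R]_n :=
  lim (series (fun k => (k`!%:R)^-1 *: A ^+ k) @ \oo).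

(* f(s)/s, continuously extended at 0. *)
Definition quotient0 (f : R -> R) (s : R) : R :=
  if s == 0 then derive1 f 0 else f s / s.

Definition nodal_diag n d (p : 'I_n -> 'rV[R]_d) (u : 'rV[R]_d -> R) :
    'M[R]_n :=
  diag_mx (\row_i u (p i)).

Definition coef_diag n (g : R -> R) (U : 'cV[R]_n) : 'M[R]_n :=
  diag_mx (\row_i g (U i ord0)).

Variables (n K : nat) (tau : R) (g : R -> R) (ML S : 'M[R]_n).
Variables (De : 'I_K -> 'M[R]_n) (Omega : Type) (B : 'I_K -> R -> Omega -> R).

Definition increment (k : 'I_K) (m : nat) (w : Omega) : R :=
  B k (m.+1%:R * tau) w - B k (m%:R * tau) w.

Definition lie_trotter_step (m : nat) (w : Omega) (U : 'cV[R]_n) : 'cV[R]_n :=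
  expmx (- tau *: (invmx ML *m S)) *m
  (expmx (\sum_k increment k m w *: (coef_diag g U *m De k)
          - (tau / 2) *: \sum_k (coef_diag g U ^+ 2 *m De k ^+ 2)) *m U).

Fixpoint lie_trotter (U0 : 'cV[R]_n) (m : nat) (w : Omega) : 'cV[R]_n :=
  if m is m'.+1 then lie_trotter_step m' w (lie_trotter U0 m' w) else U0.

End scheme.

(* Main.v *)
Require Import Defs.
From mathcomp Require Import all_boot all_order all_algebra.
From mathcomp Require Import all_classical all_reals all_analysis.
From mathcomp Require Import measurable_realfun ring lra.

Set Implicit Arguments.
Unset Strict Implicit.
Unset Printing Implicit Defensive.

Import Order.TTheory GRing.Theory Num.Theory.
Import numFieldNormedType.Exports.

Local Open Scope classical_set_scope.
Local Open Scope ring_scope.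

(** One time step multiplies the current nodal vector by two matrix
    exponentials, so it suffices that both have nonnegative entries. This holds
    for the exponential of every matrix A whose off-diagonal entries are
    nonnegative: for large c the matrix A + c has nonnegative entries, hence so
    does exp(A + c) = exp(c) exp(A), and exp(c) > 0. The lemma is
    [expmx_metzler_ge0]; the identity exp(A + c) = exp(c) exp(A) enters only
    through its Cauchy product, in [cauchy_product_limit_ge0].

    The nonlinear factor is the exponential of a diagonal matrix, whose
    off-diagonal entries vanish. The linear factor is the exponential of
    -tau M^-1 S, where M is the lumped mass matrix and S the stiffness matrix;
    here one needs nonnegative weights on the diagonal of M and nonpositive
    off-diagonal entries of S.

    - A nodal function is affine on every simplex and takes only the values 0
      and 1 at the vertices, so it is nonnegative ([nodal_ge0]), and so is its
      integral.
    - Weak acuteness bounds the integral over each simplex of the product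
      grad Phi_i . grad Phi_j. That product is constant inside the simplex, so
      the constant is nonpositive unless the simplex is null. Since the faces
      of the simplices lie in null hyperplanes, and the gradients vanish in the
      part of the domain that the mesh does not cover, the product is almost
      everywhere nonpositive on the whole domain ([stiffness_offdiag_le0]).

    The pointwise gradients have no specified value on the faces, and nothing
    makes their product measurable there. The integrals are therefore handled
    through [eq_integral_ae]: the Lebesgue integral, being a supremum over
    simple functions, ignores the values taken on a null set by any function,
    measurable or not. *)

(** * Exponentials of matrices with nonnegative off-diagonal entries *)

Section cauchy_product.
Variable R : realType.

(** The partial sums of the Cauchy product are the sums t N of the partial sums
    of a with weights w. Were the limit of the latter negative, all but
    boundedly many of the terms of t N would be nonpositive, the term of weight
    w 0 would stay below a fixed negative number, and the exceptional terms
    would carry weights from the tail of a convergent series; so t N would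
    become negative. *)
Lemma cauchy_product_limit_ge0 (w a : R^nat) :
  (forall i, 0 <= w i) -> 0 < w 0%N -> cvgn (series w) -> cvgn (series a) ->
  (forall n, 0 <= \sum_(0 <= i < n.+1) w i * a (n - i)%N) ->
  0 <= limn (series a).
Proof.
move=> w_ge0 w0_gt0 w_cvg a_cvg wa_ge0; set s := limn (series a).
rewrite leNgt; apply/negP => s_lt0.
pose t N := \sum_(0 <= i < N) w i * series a (N - i)%N.
have t_ge0 N : 0 <= t N.
  elim: N => [|N IHN]; first by rewrite /t big_geq.
  suff -> : t N.+1 = t N + \sum_(0 <= i < N.+1) w i * a (N - i)%N.
    exact: addr_ge0.
  have -> : t N = \sum_(0 <= i < N.+1) w i * series a (N - i)%N.
    rewrite big_nat_recr //= subnn /series /= (@big_geq _ _ _ 0 0) // mulr0.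
    by rewrite addr0.
  rewrite /t -big_split /=; apply: eq_big_nat => i /andP[_ iN].
  by rewrite -mulrDr subSn // seriesSr.
have [m0 _ a_le] : \forall k \near \oo, series a k <= s / 2.
  by apply: (cvgr_le s); [exact: a_cvg|lra].
have [C C_gt0 a_leC] : exists2 C, 0 < C & forall k, series a k <= C.
  have [C [_ /(_ (`|C| + 1))]] := cvg_seq_bounded a_cvg.
  have C1 : C < `|C| + 1 by rewrite (le_lt_trans (ler_norm _))// ltrDl.
  move=> /(_ C1) aC; exists (`|C| + 1); first by rewrite ltr_wpDl.
  by move=> k; rewrite (le_trans (ler_norm _))//; exact: aC.
have tail_cvg : (fun k => series w (k + m0.+1)%N - series w k.+1) @ \oo --> 0.
  rewrite -(subrr (limn (series w))); apply: cvgB.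
    by rewrite (cvg_shiftn m0.+1 (series w)).
  by rewrite (cvg_shiftS (series w)).
have /(cvgr_lt (0 : R)) := tail_cvg.
(* C times a tail below this bound cannot offset the term s / 2 * w 0 *)
have e_gt0 : 0 < - (s / 2 * w 0%N) / C.
  by rewrite divr_gt0// -mulNr mulr_gt0//; lra.
move=> /(_ _ e_gt0)[k0 _ /(_ k0 (leqnn _))] /=.
rewrite ltr_pdivlMr// => tail_lt.
have := t_ge0 (k0 + m0.+1)%N; apply/negP; rewrite -ltNge /t.
(* the index of series a exceeds m0 exactly in the first part *)
rewrite (@big_cat_nat _ _ _ k0.+1)//=; last by rewrite addnS ltnS leq_addr.
suff : \sum_(0 <= i < k0.+1) w i * series a (k0 + m0.+1 - i)%N <=
    s / 2 * w 0%N /\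
  \sum_(k0.+1 <= i < k0 + m0.+1) w i * series a (k0 + m0.+1 - i)%N <=
  (series w (k0 + m0.+1)%N - series w k0.+1) * C by lra.
split.
  rewrite big_nat_recl//= subn0 -[leRHS]addr0; apply: lerD.
    rewrite mulrC ler_wpM2r//.
    by apply: a_le; rewrite /= addnS ltnW// ltnS leq_addl.
  rewrite big_nat; apply: sumr_le0 => i /andP[_ ik].
  rewrite mulr_ge0_le0//; apply: le_trans (a_le _ _) _; last by lra.
  by rewrite /= addnS subSS -addnBAC ?leq_addl// ltnW.
rewrite /series /= (@big_cat_nat _ _ _ k0.+1 0 (k0 + m0.+1))//=; last first.
  by rewrite addnS ltnS leq_addr.
rewrite addrAC subrr add0r mulr_suml; apply: ler_sum => i _.
by rewrite ler_wpM2l//; exact: a_leC.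
Qed.

End cauchy_product.

Section matrix_exponential.
Variable R : realType.

(** Neighbourhoods of a matrix are products of neighbourhoods of its finitely
    many entries. *)
Lemma cvg_mx_entries m n (u : nat -> 'M[R]_(m, n)) (L : 'M[R]_(m, n)) :
  (forall i j, (fun k => u k i j) @ \oo --> L i j) -> u @ \oo --> L.
Proof.
move=> uL A [Q LQ QA].
have : \forall k \near \oo, forall i j, Q i j (u k i j).
  by apply: filter_forall => i; apply: filter_forall => j; exact: uL.
by apply: filterS => k Qk; exact: QA.
Qed.

Variable n : nat.
Implicit Type A : 'M[R]_n.

(** The entrywise l^1 norm is submultiplicative and dominates each entry; this
    compares the entries of the exponential series with a scalar one. *)
Lemma mx_exp_entry_bound A k i j :
  `|(A ^+ k) i j| <= (\sum_p \sum_q `|A p q|) ^+ k.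
Proof.
elim: k i j => [|k IHk] i j.
  by rewrite !expr0 mxE; case: (_ == _); rewrite ?normr1// normr0.
rewrite exprSr -mulmxE mxE (le_trans (ler_norm_sum _ _ _))// exprSr mulr_sumr.
apply: ler_sum => p _; rewrite normrM ler_pM// (bigD1 j)//= lerDl.
by rewrite sumr_ge0.
Qed.

Definition expmx_coeff A i j : R^nat := fun k => (k`!%:R)^-1 * (A ^+ k) i j.

Lemma is_cvg_expmx_coeff A i j : cvgn (series (expmx_coeff A i j)).
Proof.
apply: normed_cvg; pose s : R := \sum_p \sum_q `|A p q|.
apply: (@series_le_cvg _ _ (exp_coeff s)) => [k|k|k|].
- exact: normr_ge0.
- by apply: exp_coeff_ge0; rewrite sumr_ge0// => p _; rewrite sumr_ge0.
- rewrite /expmx_coeff /exp_coeff /= normrM ger0_norm ?invr_ge0// mulrC.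
  by rewrite ler_wpM2r ?invr_ge0// mx_exp_entry_bound.
- exact: is_cvg_series_exp_coeff.
Qed.

Lemma expmx_entry A i j : expmx A i j = limn (series (expmx_coeff A i j)).
Proof.
pose L : 'M[R]_n := \matrix_(i, j) limn (series (expmx_coeff A i j)).
suff -> : expmx A = L by rewrite mxE.
apply: cvg_lim => //; apply: cvg_mx_entries => p q; rewrite mxE.
rewrite [X in X @ _ --> _](_ : _ = series (expmx_coeff A p q)).
  exact: is_cvg_expmx_coeff.
apply/funext => k; rewrite /series /= summxE; apply: eq_bigr => l _.
by rewrite mxE.
Qed.

Lemma mx_exp_ge0 A : (forall i j, 0 <= A i j) ->
  forall k i j, 0 <= (A ^+ k) i j.
Proof.
move=> A_ge0; elim=> [|k IHk] i j; first by rewrite expr0 mxE ler0n.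
by rewrite exprS -mulmxE mxE sumr_ge0// => p _; rewrite mulr_ge0.
Qed.

(** Adding a large multiple c of the identity makes all entries nonnegative, and
    exp(A + c) is the Cauchy product of exp(c) and exp(A). *)
Lemma expmx_metzler_ge0 A : (forall i j, i != j -> 0 <= A i j) ->
  forall i j, 0 <= expmx A i j.
Proof.
move=> A_off i j; rewrite expmx_entry.
pose c : R := \sum_p `|A p p|.
have c_ge0 : 0 <= c by rewrite sumr_ge0.
apply: (@cauchy_product_limit_ge0 _ (exp_coeff c)).
- by move=> k; exact: exp_coeff_ge0.
- by rewrite /exp_coeff /= expr0 divr1.
- exact: is_cvg_series_exp_coeff.
- exact: is_cvg_expmx_coeff.
have Ac_ge0 p q : 0 <= (A + c%:M) p q.
  rewrite !mxE; have [->|pq] := eqVneq p q; last by rewrite addr0 A_off.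
  rewrite mulr1n -lerBlDl sub0r (le_trans (ler_norm _))// normrN.
  by rewrite /c (bigD1 q)//= lerDl sumr_ge0.
(* the binomial formula for the k-th term of exp(A + c) *)
move=> k; suff -> :
    \sum_(0 <= l < k.+1) exp_coeff c l * expmx_coeff A i j (k - l)%N =
    (k`!%:R)^-1 * ((A + c%:M) ^+ k) i j.
  by rewrite mulr_ge0 ?invr_ge0// mx_exp_ge0.
rewrite exprDn_comm; last by exact: comm_mx_scalar.
rewrite summxE mulr_sumr big_mkord; apply: eq_bigr => -[l /= lk] _.
rewrite mulmxnE -mulmxE -rmorphXn /= mul_mx_scalar mxE.
rewrite /exp_coeff /expmx_coeff /=.
have fact_neq0 (q : nat) : q`!%:R != 0 :> R by rewrite pnatr_eq0 -lt0n fact_gt0.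
have /(congr1 (fun q => q%:R : R)) := bin_fact (lk : (l <= k)%N).
rewrite !natrM => <-; rewrite -mulr_natl.
by field; rewrite !fact_neq0 /= pnatr_eq0 -lt0n bin_gt0.
Qed.

End matrix_exponential.

(** * Integrals of functions known almost everywhere *)

Section ae_integral.
Context (dT : measure_display) (T : measurableType dT) (R : realType).
Variable mu : {measure set T -> \bar R}.
Import HBNNSimple.
Local Open Scope ereal_scope.

(** A simple function below f can be cut off to zero on the exceptional null
    set; its integral does not change, and it is then below g. Only the simple
    functions have to be measurable. *)
Lemma ge0_ae_le_integral (f g : T -> \bar R) :
  (forall x, 0 <= f x) -> (forall x, 0 <= g x) ->
  {ae mu, forall x, f x <= g x} -> \int[mu]_x f x <= \int[mu]_x g x.
Proof.
move=> f_ge0 g_ge0 [N [mN muN0 N_fg]].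
rewrite (ge0_integralTE _ f_ge0) (ge0_integralTE _ g_ge0).
apply: ge_ereal_sup => _ [h hf <-]; apply: ereal_sup_ubound.
exists (proj_nnsfun h (measurableC mN)) => /= [x|].
  rewrite mindicE; have [xN|xN] := boolP (x \in ~` N).
    rewrite mulr1; apply: le_trans (hf x) _; apply: contrapT => fg.
    by move: xN; rewrite inE => /=; apply; exact: N_fg.
  by rewrite mulr0.
rewrite -!integralT_nnsfun /=.
rewrite [RHS](ge0_negligible_integral mN)//; last 2 first.
- exact/measurable_EFinP.
- by move=> x _; rewrite lee_fin.
rewrite setTD [RHS]integral_mkcond; apply: eq_integral => x _.
rewrite patchE mindicE; case: (x \in _); first by rewrite mulr1.
by rewrite mulr0.
Qed.

Lemma eq_integral_ae (D E : set T) (f g : T -> \bar R) :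
  {ae mu, forall x, (f \_ D) x = (g \_ E) x} ->
  \int[mu]_(x in D) f x = \int[mu]_(x in E) g x.
Proof.
move=> fg; rewrite integral_mkcond [RHS]integral_mkcond.
rewrite integralE [RHS]integralE; congr (_ - _); apply/eqP; rewrite eq_le;
  apply/andP; split; apply: ge0_ae_le_integral => //;
  by apply: filterS fg => x fgx; rewrite ?funeposE ?funenegE fgx.
Qed.

Lemma ae_le0_integral_le0 (D : set T) (f : T -> \bar R) :
  {ae mu, forall x, D x -> f x <= 0} -> \int[mu]_(x in D) f x <= 0.
Proof.
move=> f_le0; rewrite integralE.
rewrite (@eq_integral_ae D D (f ^\+) (cst 0)) ?integral0 ?sub0e.
  by rewrite oppe_le0 integral_ge0.
apply: filterS f_le0 => x f_le0; rewrite !patchE.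
by case: ifPn => // /set_mem/f_le0; rewrite funeposE => /max_idPr.
Qed.

End ae_integral.

(** * Hyperplanes are null sets *)

Section hyperplane.
Variable R : realType.
Local Notation leb := (lebesgue_rV R).

Lemma measurable_dotp d (a : 'rV[R]_d) : measurable_fun setT (dotp a).
Proof.
apply: measurable_sum => i; apply: measurable_funM => //.
exact: measurable_coor.
Qed.

Lemma measurable_affine d (a : 'rV[R]_d) (b : R) :
  measurable_fun setT (fun x => dotp a x + b).
Proof. by apply: measurable_funD => //; exact: measurable_dotp. Qed.

Lemma dotp_consrV d (a : 'rV[R]_d.+1) (p : R * 'rV[R]_d) :
  dotp a (consrV p) =
  a ord0 ord0 * p.1 + dotp (\row_i a ord0 (lift ord0 i)) p.2.
Proof.
rewrite /dotp big_ord_recl consrV0; congr (_ + _).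
by apply: eq_bigr => i _; rewrite consrVS mxE.
Qed.

Lemma measurable_hyperplane d (a : 'rV[R]_d) b :
  measurable [set x | dotp a x + b = 0].
Proof.
have := measurable_affine a b measurableT (@measurable_set1 R 0).
by rewrite setTI.
Qed.

(** By induction on the dimension, slicing along the first coordinate. If the
    normal vector is parallel to the first axis, the hyperplane is a point times
    a whole space; otherwise every slice is a hyperplane of the smaller
    space. *)
Lemma hyperplane_null d (a : 'rV[R]_d) b :
  a != 0 -> leb d [set x | dotp a x + b = 0] = 0%E.
Proof.
elim: d a b => [|d IHd] a b a_neq0.
  by case/eqP: a_neq0; apply/rowP => -[].
rewrite /= /lebesgue_step /pushforward.
set a' := \row_i a ord0 (lift ord0 i).
have [a'0|a'_neq0] := eqVneq a' 0.
  have a0_neq0 : a ord0 ord0 != 0.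
    apply: contraNneq a_neq0 => a00; apply/eqP/rowP => i.
    case: (unliftP ord0 i) => [j ->|->]; last by rewrite a00 mxE.
    by move/rowP : a'0 => /(_ j); rewrite !mxE.
  rewrite (_ : _ @^-1` _ = [set - b / a ord0 ord0] `*` setT).
    rewrite product_measure1E//= [X in (X * _)%E](_ : _ = 0%E) ?mul0e//.
    exact: lebesgue_measure_set1.
  apply/seteqP; split => -[t y] /=; rewrite dotp_consrV -/a' a'0 /dotp /=;
    rewrite big1 ?addr0; try by move=> i _; rewrite mxE mul0r.
    move=> /eqP; rewrite addr_eq0 => /eqP tb; split=> //.
    by rewrite -tb mulrC mulKf.
  by move=> [-> _]; rewrite mulrC divfK// addNr.
rewrite /product_measure1 -[RHS](integral0 (lebesgue1 (R:=R)) setT).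
apply: eq_integral => t _ /=.
rewrite -[RHS](IHd a' (a ord0 ord0 * t + b) a'_neq0).
congr (leb d _); apply/funext => y; rewrite /xsection /= inE /=.
by rewrite dotp_consrV /= -/a' (addrC (_ * t)) -addrA.
Qed.

Lemma ae_notin_hyperplane d (a : 'rV[R]_d) b :
  a != 0 -> {ae leb d, forall x, dotp a x + b != 0}.
Proof.
move=> a_neq0; exists [set x | dotp a x + b = 0]; split.
- exact: measurable_hyperplane.
- exact: hyperplane_null.
- by move=> x /negP; rewrite negbK => /eqP.
Qed.

End hyperplane.

(** * Affine functions and barycentric coordinates *)

Section dot_product.
Variables (R : realType) (d : nat).
Implicit Types a x y : 'rV[R]_d.

Lemma dotpDr a x y : dotp a (x + y) = dotp a x + dotp a y.
Proof. by rewrite -big_split; apply: eq_bigr => i _; rewrite mxE mulrDr. Qed.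

Lemma dotpZr a (c : R) x : dotp a (c *: x) = c * dotp a x.
Proof. by rewrite mulr_sumr; apply: eq_bigr => i _; rewrite mxE mulrCA. Qed.

Lemma dotpBr a x y : dotp a (x - y) = dotp a x - dotp a y.
Proof. by rewrite dotpDr -scaleN1r dotpZr mulN1r. Qed.

Lemma dotp_delta a i : dotp a (delta_mx ord0 i) = a ord0 i.
Proof.
rewrite /dotp (bigD1 i)//= big1 ?addr0 => [|j ji]; rewrite mxE eqxx.
  by rewrite eqxx mulr1.
by rewrite (negbTE ji) mulr0.
Qed.

Lemma dotp_mulmx a m (l : 'rV[R]_m) (V : 'M[R]_(m, d)) :
  dotp a (l *m V) = \sum_i l ord0 i * dotp a (row i V).
Proof.
rewrite mulmx_sum_row; elim/big_rec2: _ => [|i u v _ <-].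
  by rewrite /dotp big1// => i _; rewrite mxE mulr0.
by rewrite dotpDr dotpZr.
Qed.

Lemma dot0p x : dotp 0 x = 0.
Proof. by rewrite /dotp big1// => i _; rewrite mxE mul0r. Qed.

Lemma dotp_suml I (r : seq I) (a : I -> 'rV[R]_d) x :
  dotp (\sum_(i <- r) a i) x = \sum_(i <- r) dotp (a i) x.
Proof.
by rewrite exchange_big; apply: eq_bigr => j _; rewrite summxE mulr_suml.
Qed.

Lemma continuous_dotp a : continuous (dotp a).
Proof.
rewrite (_ : dotp a = \sum_i (fun x : 'rV[R]_d => a ord0 i * x ord0 i)).
  elim/big_ind: _ => [x|f g cf cg x|i _ x].
    exact: (@cst_continuous _ _ (0 : R)).
    exact: (cvgD (cf x) (cg x)).
  apply: continuousM => [|? ?]; first exact: cst_continuous.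
  exact: coord_continuous.
by apply/funext => x; rewrite fct_sumE.
Qed.

(** The difference quotients of an affine function are constant, and those of u
    coincide with them near 0. *)
Lemma grad_near_affine (u : 'rV[R]_d -> R) a (b : R) x :
  (\forall y \near x, u y = dotp a y + b) -> grad u x = a.
Proof.
move=> u_affine; apply/rowP => i; rewrite mxE /partial.
rewrite (@near_eq_derive _ _ _ _ (fun y => dotp a y + b))// -dotp_delta.
apply: cvg_lim => //; apply: cvg_near_cst; near=> h => /=.
have h_neq0 : h != 0 by near: h; exact: nbhs_dnbhs_neq.
by rewrite dotpDr dotpZr -(addrA _ _ b) addrK; exact: mulKf.
Unshelve. all: by end_near. Qed.

End dot_product.

Section barycentric.
Variables (R : realType) (d : nat).
Implicit Types (V : 'M[R]_(d.+1, d)) (x : 'rV[R]_d).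
Local Notation leb := (lebesgue_rV R).

Definition edge_mx V : 'M[R]_d :=
  \matrix_(i < d) (row (lift ord0 i) V - row ord0 V).

Definition bary_slope V (i : 'I_d.+1) : 'rV[R]_d :=
  if unlift ord0 i is Some j then (col j (invmx (edge_mx V)))^T
  else - \sum_j (col j (invmx (edge_mx V)))^T.

(** The i-th barycentric coordinate with respect to the vertices of V, as an
    affine function on the whole space: for i > 0 it is the coordinate of
    x - V_0 along the i-th edge at V_0, and the coordinate for i = 0 makes the
    sum equal to 1. *)
Definition bary V i x : R :=
  dotp (bary_slope V i) (x - row ord0 V) + (i == ord0)%:R.

Lemma bary_lift V j x :
  bary V (lift ord0 j) x = ((x - row ord0 V) *m invmx (edge_mx V)) ord0 j.
Proof.
rewrite /bary /bary_slope liftK addr0 mxE; apply: eq_bigr => k _.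
by rewrite mulrC !mxE.
Qed.

Lemma bary_slope_sum V : \sum_i bary_slope V i = 0.
Proof.
rewrite big_ord_recl /bary_slope unlift_none.
rewrite [X in _ + X](eq_bigr (fun j => (col j (invmx (edge_mx V)))^T)).
  by rewrite addNr.
by move=> j _; rewrite liftK.
Qed.

Lemma bary_sum V x : \sum_i bary V i x = 1.
Proof.
rewrite big_split /= -dotp_suml bary_slope_sum dot0p add0r (bigD1 ord0)//=.
by rewrite big1 ?addr0// => i /negbTE ->.
Qed.

Lemma affine_combination V (l : 'rV[R]_d.+1) : \sum_i l ord0 i = 1 ->
  l *m V - row ord0 V = (\row_j l ord0 (lift ord0 j)) *m edge_mx V.
Proof.
move=> l1; have -> : l *m V - row ord0 V =
    \sum_i l ord0 i *: (row i V - row ord0 V).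
  under eq_bigr do rewrite scalerBr.
  by rewrite sumrB -scaler_suml l1 scale1r mulmx_sum_row.
rewrite big_ord_recl subrr scaler0 add0r mulmx_sum_row.
by apply: eq_bigr => j _; rewrite rowK mxE.
Qed.

Lemma baryK V x : Defs.nondegenerate V -> (\row_i bary V i x) *m V = x.
Proof.
rewrite /Defs.nondegenerate -/(edge_mx V) row_free_unit => V_unit.
apply/eqP; rewrite -(subr_eq0 _ x); apply/eqP.
rewrite -[X in X - _](subrK (row ord0 V)) affine_combination; last first.
  by rewrite -[RHS](bary_sum V x); apply: eq_bigr => i _; rewrite mxE.
rewrite (_ : \row_j _ = (x - row ord0 V) *m invmx (edge_mx V)).
  by rewrite mulmxKV// addrNK subrr.
by apply/rowP => j; rewrite mxE mxE bary_lift.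
Qed.

Lemma bary_combination V (l : 'rV[R]_d.+1) i : Defs.nondegenerate V ->
  \sum_i l ord0 i = 1 -> bary V i (l *m V) = l ord0 i.
Proof.
rewrite /Defs.nondegenerate -/(edge_mx V) row_free_unit => V_unit l1.
have lift_eq j : bary V (lift ord0 j) (l *m V) = l ord0 (lift ord0 j).
  by rewrite bary_lift affine_combination// mulmxK// mxE.
case: (unliftP ord0 i) => [j ->//|->].
have := bary_sum V (l *m V); rewrite -l1 !big_ord_recl.
under eq_bigr do rewrite lift_eq.
exact: addIr.
Qed.

Lemma simplexE V x : Defs.nondegenerate V ->
  simplex V x <-> forall i, 0 <= bary V i x.
Proof.
move=> ndV; split => [[l [l_ge0 l1 ->]] i|x_ge0].
  by rewrite bary_combination.
exists (\row_i bary V i x); split => [i||]; first by rewrite mxE.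
  by rewrite -[RHS](bary_sum V x); apply: eq_bigr => i _; rewrite mxE.
by rewrite baryK.
Qed.

Lemma bary_vertex V i j : Defs.nondegenerate V ->
  bary V i (row j V) = (j == i)%:R.
Proof.
move=> ndV; rewrite rowE bary_combination//; first by rewrite mxE eqxx eq_sym.
rewrite (bigD1 j)//= big1 ?addr0 => [|k kj]; rewrite mxE eqxx ?eqxx//.
by rewrite (negbTE kj).
Qed.

(** A coordinate takes the values 1 and 0 at two different vertices; there are
    at least two of them in positive dimension. *)
Lemma bary_slope_neq0 V i : (0 < d)%N -> Defs.nondegenerate V ->
  bary_slope V i != 0.
Proof.
move=> d_gt0 ndV; pose j := lift i (Ordinal d_gt0).
have ij : j == i = false by rewrite eq_sym; apply/negbTE/neq_lift.
apply/eqP => s0; have := bary_vertex i j ndV.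
rewrite /bary s0 !dot0p ij add0r => i_eq; have := bary_vertex i i ndV.
by rewrite /bary s0 dot0p add0r i_eq eqxx => /esym/eqP; rewrite oner_eq0.
Qed.

Definition open_simplex V : set 'rV[R]_d := [set x | forall i, 0 < bary V i x].

Lemma open_simplex_sub V : Defs.nondegenerate V ->
  open_simplex V `<=` simplex V.
Proof. by move=> ndV x Ox; apply/simplexE => // i; exact/ltW. Qed.

Lemma baryE V i x :
  bary V i x = dotp (bary_slope V i) x +
    ((i == ord0)%:R - dotp (bary_slope V i) (row ord0 V)).
Proof. by rewrite /bary dotpBr addrAC addrA. Qed.

Lemma continuous_bary V i : continuous (bary V i).
Proof.
rewrite (funext (baryE V i)) => x.
exact: (cvgD (@continuous_dotp _ _ (bary_slope V i) x) (cvg_cst _)).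
Qed.

Lemma open_simplex_nbhs V x :
  open_simplex V x -> \forall y \near x, open_simplex V y.
Proof.
move=> Ox; suff : \forall y \near x, forall i, 0 < bary V i y by [].
apply: (@filter_forall _ _ (fun i y => 0 < bary V i y) _ (nbhs_filter x)) => i.
exact: (cvgr_gt _ (@continuous_bary V i x) _ (Ox i)).
Qed.

Lemma measurable_open_simplex V : measurable (open_simplex V).
Proof.
rewrite (_ : open_simplex V =
    \bigcap_(i in setT) (bary V i @^-1` [set r | 0 < r])); last first.
  by apply/seteqP; split => x /= h i => [_|]; exact: h.
apply: fin_bigcap_measurable => // i _.
rewrite -[X in measurable X]setTI.
have : measurable_fun setT (bary V i).
  by rewrite (funext (baryE V i)); exact: measurable_affine.
apply => //; rewrite (_ : [set r | 0 < r] = `]0, +oo[%classic).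
  exact: measurable_itv.
by apply/seteqP; split => r /=; rewrite in_itv /= andbT.
Qed.

Lemma measurable_box (A : 'I_d -> set R) : (forall i, measurable (A i)) ->
  measurable [set x : 'rV[R]_d | forall i, A i (x ord0 i)].
Proof.
move=> A_meas; rewrite (_ : [set _ | _] =
    \bigcap_(i in setT) ((fun x : 'rV_d => x ord0 i) @^-1` A i)); last first.
  by apply/seteqP; split => x /= h i => [_|]; exact: h.
apply: fin_bigcap_measurable => // i _.
by rewrite -[X in measurable X]setTI; exact: measurable_coor.
Qed.

(** The open simplex lies in a cube: a convex combination of the vertices has
    coordinates bounded by the sum of the sizes of all entries of V. *)
Lemma open_simplex_finite V : Defs.nondegenerate V ->
  (leb d (open_simplex V) < +oo)%E.
Proof.
move=> ndV; pose C : R := \sum_i \sum_j `|V i j|.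
pose A (i : 'I_d) : set R := `[- C, C]%classic.
have A_meas i : measurable (A i) by exact: measurable_itv.
apply: (@le_lt_trans _ _ (leb d [set x | forall i, A i (x ord0 i)])).
  apply: le_measure; rewrite ?inE.
  - exact: measurable_open_simplex.
  - exact: measurable_box.
  move=> x /(open_simplex_sub ndV)[l [l_ge0 l1 ->]] j /=.
  rewrite /A /= in_itv /= -ler_norml mxE (le_trans (ler_norm_sum _ _ _))//.
  apply: ler_sum => i _; rewrite normrM ger0_norm//.
  have l_le1 : l ord0 i <= 1.
    by rewrite -l1 (bigD1 i)//= lerDl sumr_ge0.
  rewrite (le_trans (ler_piMl _ _))// (bigD1 j)//= lerDl sumr_ge0//.
rewrite lebesgue_rV_box// ltey_eq prode_fin_num// => i _.
rewrite /lebesgue1 lebesgue_measure_itv /=; case: ifP => // _.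
Qed.

(** A point of the simplex with a vanishing barycentric coordinate lies on one
    of the d + 1 hyperplanes that carry the faces. *)
Lemma ae_open_simplex V : (0 < d)%N -> Defs.nondegenerate V ->
  {ae leb d, forall x, simplex V x -> open_simplex V x}.
Proof.
move=> d_gt0 ndV.
have : {ae leb d, forall x, forall i, bary V i x != 0}.
  apply: filter_forall => i.
  pose b : R := (i == ord0)%:R - dotp (bary_slope V i) (row ord0 V).
  apply: filterS (ae_notin_hyperplane b (bary_slope_neq0 i d_gt0 ndV)) => x.
  by rewrite -baryE.
apply: filterS => x x_neq0 /(simplexE _ ndV) x_ge0 i.
by rewrite lt_neqAle eq_sym x_neq0 x_ge0.
Qed.

End barycentric.

(** * Signs of the finite element matrices *)

Section finite_element_matrices.
Variables (R : realType) (d : nat) (D Dh : set 'rV[R]_d).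
Variables (N : nat) (V : 'I_N -> 'M[R]_(d.+1, d)).
Hypothesis d_gt0 : (0 < d)%N.
Hypothesis mesh : triangulation D Dh V.
Local Notation leb := (lebesgue_rV R d).

(** The integral equals c times the volume of the simplex, so that either c <= 0
    or the volume is 0. Finiteness of the volume matters: the real-valued
    integral is 0 when the extended one is infinite. *)
Lemma ae_le0_simplex (W : 'M[R]_(d.+1, d)) (f : 'rV[R]_d -> R) (c : R) :
  Defs.nondegenerate W -> (forall x, open_simplex W x -> f x = c) ->
  \int[leb]_(x in simplex W) f x <= 0 ->
  {ae leb, forall x, simplex W x -> f x <= 0}.
Proof.
move=> ndW f_c int_le0.
have ae_int := ae_open_simplex d_gt0 ndW.
have [c_le0|c_gt0] := leP c 0.
  by apply: filterS ae_int => x x_int /x_int/f_c ->.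
have vol0 : leb (open_simplex W) = 0%E.
  have vol_fin : leb (open_simplex W) \is a fin_num.
    by rewrite ge0_fin_numE//; exact: open_simplex_finite.
  move: int_le0; rewrite /Rintegral.
  rewrite (@eq_integral_ae _ _ _ _ _ (open_simplex W) _ (cst c%:E)); last first.
    apply: filterS ae_int => x x_int; rewrite !patchE.
    have [xO|xO] := boolP (x \in open_simplex W).
      rewrite mem_set ?f_c//; first exact: set_mem.
      exact/open_simplex_sub/set_mem.
    by case: ifPn => // /set_mem/x_int/mem_set; rewrite (negbTE xO).
  rewrite integral_cst; last exact: measurable_open_simplex.
  rewrite fineM// pmulr_rle0// -(fineK vol_fin) => vol_le0.
  by congr (_%:E); apply/eqP; rewrite eq_le vol_le0 fine_ge0.
have : {ae leb, forall x, ~ open_simplex W x}.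
  exists (open_simplex W); split => //; first exact: measurable_open_simplex.
  by move=> x /= /contrapT.
by apply: filterS2 ae_int => x x_int x_ext /x_int.
Qed.

Lemma meshed_open : open D.
Proof.
by case: mesh => -[[[[_ _ oD _] _] _]|[[[_ _ oD _] _ _] _ _ _]] _ _ _.
Qed.

Lemma meshed_closure_sub : closure Dh `<=` closure D.
Proof.
by case: mesh => -[[_ ->]|[_ _ /closure_subset sub _]] _ _ _.
Qed.

Lemma in_closure_mesh x : closure Dh x <-> exists k, simplex (V k) x.
Proof.
by case: mesh => _ _ -> _; split=> [[k _ Vx]|[k Vx]]; exists k.
Qed.

Variables (n : nat) (p : 'I_n -> 'rV[R]_d) (Phi : 'I_n -> 'rV[R]_d -> R).
Hypothesis p_vertices : interior_vertices D V p.
Hypothesis Phi_basis : nodal_basis D Dh V p Phi.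

(** A vertex of the mesh lies in the closure of D. It is either inside D, and
    then a node, where nodal functions take the value 0 or 1, or on the
    boundary, where they vanish. *)
Lemma nodal_vertex_ge0 j k i : 0 <= Phi j (row i (V k)).
Proof.
case: mesh => _ V_nd _ _; case: Phi_basis => /(_ j)[[_ Phi_bd] _ _] Phi_node.
have vertex_in : closure D (row i (V k)).
  apply: meshed_closure_sub; apply/in_closure_mesh; exists k.
  by apply/simplexE => // l; rewrite bary_vertex.
have [vD|vD] := pselect (D (row i (V k))); last first.
  rewrite Phi_bd//; split=> //.
  by move=> /interior_subset.
case: p_vertices => _ p_range.
have : range p (row i (V k)) by rewrite p_range; split=> //; exists k, i.
by case=> l _ <-; rewrite Phi_node.
Qed.

(** On a simplex an affine function is the average of its values at the
    vertices, weighted by barycentric coordinates; outside the mesh nodal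
    functions vanish. *)
Lemma nodal_ge0 j x : D x -> 0 <= Phi j x.
Proof.
move=> Dx; case: Phi_basis => /(_ j)[_ Phi_affine Phi_out] _.
have [Dhx|Dhx] := pselect (Dh x); last by rewrite Phi_out.
have /in_closure_mesh[k Vx] := subset_closure Dhx.
have [a [b Phi_ab]] := Phi_affine k; rewrite Phi_ab//.
have [l [l_ge0 l1 ->]] := Vx.
have V_nd : Defs.nondegenerate (V k) by case: mesh.
rewrite dotp_mulmx -[b]mul1r -l1 mulr_suml -big_split /=.
apply: sumr_ge0 => i _; rewrite -mulrDr mulr_ge0// -Phi_ab.
  exact: nodal_vertex_ge0.
by apply/simplexE => // m; rewrite bary_vertex.
Qed.

(** A point of D outside the closed mesh has a neighbourhood on which the nodal
    functions vanish; elsewhere the sign is found simplex by simplex. *)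
Lemma stiffness_offdiag_le0 i j :
  weakly_acute V Phi -> i != j -> stiffness D Phi i j <= 0.
Proof.
move=> acute ij; rewrite mxE; apply: fine_le0; apply: ae_le0_integral_le0.
case: (mesh) => _ V_nd _ _; case: Phi_basis => fe _.
have : {ae leb, forall x, forall k, simplex (V k) x ->
    dotp (grad (Phi j) x) (grad (Phi i) x) <= 0}.
  apply: filter_forall => k.
  have [_ /(_ k)[a [b Phi_ab]] _] := fe j.
  have [_ /(_ k)[a' [b' Phi_ab']] _] := fe i.
  apply: (@ae_le0_simplex _ _ (dotp a a')) => // [x Ox|].
    rewrite (@grad_near_affine _ _ _ a b) ?(@grad_near_affine _ _ _ a' b')//.
      apply: filterS (open_simplex_nbhs Ox) => y /(open_simplex_sub (V_nd k)).
      exact: Phi_ab'.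
    apply: filterS (open_simplex_nbhs Ox) => y /(open_simplex_sub (V_nd k)).
    exact: Phi_ab.
  by apply: acute; rewrite eq_sym.
apply: filterS => x x_le0 Dx; rewrite lee_fin.
have [/in_closure_mesh[k /x_le0]//|x_out] := pselect (closure Dh x).
rewrite (@grad_near_affine _ _ _ 0 0) ?dot0p//.
have [_ _ Phi_out] := fe j.
have D_nbhs : nbhs x D by apply: open_nbhs_nbhs; split=> //; exact: meshed_open.
have Dh_nbhs : nbhs x (~` closure Dh).
  apply: open_nbhs_nbhs; split=> //.
  by apply: closed_openC; exact: closed_closure.
apply: filterS2 D_nbhs Dh_nbhs => y Dy Dhy; rewrite dot0p addr0.
by apply: Phi_out => // /subset_closure.
Qed.

Lemma lumped_massE :
  lumped_mass D Phi = diag_mx (\row_i \int[leb]_(x in D) Phi i x).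
Proof.
apply/matrixP => i j; rewrite !mxE.
by case: eqP => [->|_]; rewrite ?mul1r ?mul0r.
Qed.

Lemma lumped_weight_ge0 i : 0 <= \int[leb]_(x in D) Phi i x.
Proof.
by apply/fine_ge0/integral_ge0 => x Dx; rewrite lee_fin nodal_ge0.
Qed.

End finite_element_matrices.

(** * The two factors of a Lie-Trotter step *)

Section lie_trotter.
Variable R : realType.

(** If a weight vanishes, the matrix is singular and [invmx] returns it
    unchanged, which is again diagonal with nonnegative weights. *)
Lemma invmx_diag_ge0 n (w : 'rV[R]_n) : (forall i, 0 <= w ord0 i) ->
  exists2 w' : 'rV[R]_n, forall i, 0 <= w' ord0 i &
    invmx (diag_mx w) = diag_mx w'.
Proof.
move=> w_ge0; have [w_unit|w_sing] := boolP (diag_mx w \in unitmx); last first.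
  by exists w => //; exact: invmx_out.
exists (\row_i (w ord0 i)^-1) => [i|]; first by rewrite mxE invr_ge0.
have w_neq0 i : w ord0 i != 0.
  move: w_unit; rewrite unitmxE det_diag unitfE.
  by apply: contraNneq => wi0; rewrite (bigD1 i)//= wi0 mul0r.
rewrite -[RHS](mulKmx w_unit) mulmx_diag [X in _ *m X](_ : _ = 1%:M) ?mulmx1//.
apply/matrixP => i j; rewrite !mxE; case: eqP => // _.
by rewrite divff// mulr1n.
Qed.

Lemma lie_trotter_exponent_offdiag n K tau (c : 'I_K -> R) (g : R -> R)
    (U : 'cV[R]_n) (E : 'I_K -> 'rV[R]_n) i j : i != j ->
  (\sum_k c k *: (coef_diag g U *m diag_mx (E k))
   - tau *: \sum_k (coef_diag g U ^+ 2 *m diag_mx (E k) ^+ 2)) i j = 0.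
Proof.
move=> ij; rewrite mxE summxE big1 ?add0r => [|k _]; last first.
  by rewrite mxE mulmx_diag !mxE (negbTE ij) mulr0.
rewrite mxE mxE summxE big1 ?mulr0 ?oppr0// => k _.
by rewrite !expr2 -!mulmxE !mulmx_diag !mxE (negbTE ij).
Qed.

Lemma mulmx_entry_ge0 m n q (A : 'M[R]_(m, n)) (B : 'M[R]_(n, q)) :
  (forall i j, 0 <= A i j) -> (forall i j, 0 <= B i j) ->
  forall i j, 0 <= (A *m B) i j.
Proof.
by move=> A0 B0 i j; rewrite mxE sumr_ge0// => k _; rewrite mulr_ge0.
Qed.

Lemma generator_metzler n (tau : R) (w : 'rV[R]_n) (S : 'M[R]_n) :
  0 <= tau -> (forall i, 0 <= w ord0 i) ->
  (forall i j, i != j -> S i j <= 0) ->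
  forall i j, i != j -> 0 <= (- tau *: (invmx (diag_mx w) *m S)) i j.
Proof.
move=> tau_ge0 /invmx_diag_ge0[w' w'_ge0 ->] S_le0 i j ij.
rewrite mul_diag_mx !mxE mulNr oppr_ge0 mulr_ge0_le0// mulr_ge0_le0//.
exact: S_le0.
Qed.

End lie_trotter.

Theorem theorem4p1 (R : realType) (d : nat) (T : R) (D : set 'rV[R]_d)
    (dO : measure_display) (Omega : measurableType dO) (P : probability Omega R)
    (F : R -> set (set Omega)) (K : nat) (B : 'I_K -> R -> Omega -> R)
    (e : 'I_K -> 'rV[R]_d -> R) (f : R -> R) (Lf : R) (u0 : 'rV[R]_d -> R)
    (Dh : set 'rV[R]_d) (N : nat) (V : 'I_N -> 'M[R]_(d.+1, d))
    (n : nat) (p : 'I_n -> 'rV[R]_d) (Phi : 'I_n -> 'rV[R]_d -> R)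
    (M : nat) (tau : R)
    (T_gt0 : 0 < T)
    (d_range : (1 <= d <= 3)%N)
    (D_domain : polyhedral_domain D \/ convex_C2_domain D)
    (P_complete : measure_is_complete P)
    (F_normal : normal_filtration P T F)
    (B_brownian : forall k, brownian_motion P T F (B k))
    (B_indep : independent_processes P T B)
    (e_cont : forall k, continuous_closure D (e k))
    (e_orthonormal : orthonormal_L2 D e)
    (f_derivable : forall x, derivable f x 1)
    (f_C1 : continuous (derive1 f))
    (Lf_ge0 : 0 <= Lf)
    (f_lipschitz : forall x y, `|f x - f y| <= Lf * `|x - y|)
    (f0 : f 0 = 0)
    (u0_H2 : sobolev D 2 u0)
    (u0_C0 : C0_closure D u0)
    (u0_ge0 : forall x, closure D x -> 0 <= u0 x)
    (mesh : triangulation D Dh V)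
    (mesh_admissible : admissible Dh V)
    (p_vertices : interior_vertices D V p)
    (Phi_basis : nodal_basis D Dh V p Phi)
    (Phi_acute : weakly_acute V Phi)
    (mesh_regular : shape_regular V)
    (M_gt0 : (0 < M)%N)
    (tau_def : tau = T / M%:R) :
  forall (m : nat) (w : Omega) (j : 'I_n), (m <= M)%N ->
    0 <= lie_trotter tau (quotient0 f) (lumped_mass D Phi) (stiffness D Phi)
           (fun k => nodal_diag p (e k)) B (\col_i u0 (p i)) m w j ord0.
Proof.
move=> m w j _.
have d_gt0 : (0 < d)%N by case/andP: d_range.
have tau_ge0 : 0 <= tau by rewrite tau_def divr_ge0// ltW.
elim: m j => [|m IHm] j /=.
  rewrite mxE u0_ge0//; apply: subset_closure.
  case: p_vertices => _ /seteqP[p_sub _].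
  by have [] := p_sub (p j) (imageT p j).
rewrite /lie_trotter_step; apply: mulmx_entry_ge0 => {j}.
  apply: expmx_metzler_ge0; rewrite lumped_massE.
  apply: generator_metzler => //.
    by move=> i; rewrite mxE (lumped_weight_ge0 mesh p_vertices Phi_basis).
  by move=> i j; exact: (stiffness_offdiag_le0 d_gt0 mesh Phi_basis).
(* the nodal vector has a single column *)
apply: mulmx_entry_ge0 => [|i j]; last by rewrite ord1.
apply: expmx_metzler_ge0 => i j ij; by rewrite lie_trotter_exponent_offdiag.
Qed.
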